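(* Let $(\Omega,\star)$ be a nonempty associative semigroup, and let $\mathbf{EDS}(\Omega,\star,\star)$ be the set $\Omega$ with the four operations $\alpha\leftarrow\beta=\alpha\rightarrow\beta=\alpha\star\beta$, $\alpha\triangleleft\beta=\beta$, $\alpha\triangleright\beta=\alpha$ (this is an extended diassociative semigroup). The following conditions are equivalent: 1. $\mathbf{EDS}(\Omega,\star,\star)$ is nondegenerate. 2. For $\mathbf{EDS}(\Omega,\star,\star)$, the maps $\varphi_\leftarrow$ and $\varphi_\rightarrow$ are surjective. 3. $(\Omega,\star)$ is a group. If this holds, then for any $\alpha,\beta\in\Omega$: $$\alpha\curvearrowleft\beta=\alpha\star\beta^{-1},\quad\alpha\curvearrowright\beta=\alpha^{-1}\star\beta,\quad\alpha\blacktriangleleft\beta=\beta,\quad\alpha\blacktriangleright\beta=\alpha.$$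
   Context: For a set $\Omega$ with four binary operations $\leftarrow,\rightarrow,\triangleleft,\triangleright$ (here an extended diassociative semigroup), define $\varphi_\leftarrow,\varphi_\rightarrow:\Omega^2\to\Omega^2$ by $\varphi_\leftarrow(\alpha,\beta)=(\alpha\leftarrow\beta,\alpha\triangleleft\beta)$ and $\varphi_\rightarrow(\alpha,\beta)=(\alpha\rightarrow\beta,\alpha\triangleright\beta)$. $\Omega$ is nondegenerate if both maps are bijective. In that case the operations $\curvearrowleft,\blacktriangleleft,\curvearrowright,\blacktriangleright$ on $\Omega$ are defined by $\varphi_\leftarrow^{-1}(\alpha,\beta)=(\alpha\curvearrowleft\beta,\alpha\blacktriangleleft\beta)$ and $\varphi_\rightarrow^{-1}(\alpha,\beta)=(\beta\blacktriangleright\alpha,\beta\curvearrowright\alpha)$. *)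

(* Defs.v *)
From mathcomp Require Import all_boot.
From mathcomp Require Import boolp classical_sets functions.

Set Implicit Arguments.
Unset Strict Implicit.
Unset Printing Implicit Defensive.

(* [l] is the operation written "left arrow", [r] the one written
   "right arrow". *)
Record diassociative (Omega : Type) (l r : Omega -> Omega -> Omega) : Prop := {
  dias_lA : forall a b c, l (l a b) c = l a (l b c);
  dias_lr : forall a b c, l a (l b c) = l a (r b c);
  dias_rl : forall a b c, l (r a b) c = r a (l b c);
  dias_rA : forall a b c, r (r a b) c = r a (r b c);
  dias_ll : forall a b c, r (l a b) c = r a (r b c)
}.

(* Extended diassociative semigroups: [larr], [rarr], [ltri], [rtri] are the
   operations written with the left and right arrows and with the left and
   right white triangles. *)
Record eds (Omega : Type) := EDS {
  larr : Omega -> Omega -> Omega;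
  rarr : Omega -> Omega -> Omega;
  ltri : Omega -> Omega -> Omega;
  rtri : Omega -> Omega -> Omega;
  eds_dias : diassociative larr rarr;
  eds_rtri_larr : forall a b c, rtri a (larr b c) = rtri a b;
  eds_rarr_ltri : forall a b c, ltri (rarr a b) c = ltri b c;
  eds_ltri_larr : forall a b c,
    larr (ltri a b) (ltri (larr a b) c) = ltri a (larr b c);
  eds_ltri_ltri : forall a b c,
    ltri (ltri a b) (ltri (larr a b) c) = ltri b c;
  eds_ltri_rarr : forall a b c,
    rarr (ltri a b) (ltri (larr a b) c) = ltri a (rarr b c);
  eds_ltri_rtri : forall a b c,
    rtri (ltri a b) (ltri (larr a b) c) = rtri b c;
  eds_rtri_larr' : forall a b c,
    larr (rtri a (rarr b c)) (rtri b c) = rtri (larr a b) c;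
  eds_rtri_ltri : forall a b c,
    ltri (rtri a (rarr b c)) (rtri b c) = ltri a b;
  eds_rtri_rarr : forall a b c,
    rarr (rtri a (rarr b c)) (rtri b c) = rtri (rarr a b) c;
  eds_rtri_rtri : forall a b c,
    rtri (rtri a (rarr b c)) (rtri b c) = rtri a b
}.

Definition eds_of_dias (Omega : Type) (l r : Omega -> Omega -> Omega)
  (H : diassociative l r) : eds Omega.
Proof.
by refine (@EDS Omega l r (fun _ b => b) (fun a _ => a) H
  _ _ _ _ _ _ _ _ _ _).
Defined.

Lemma assoc_dias (Omega : Type) (op : Omega -> Omega -> Omega) :
  associative op -> diassociative op op.
Proof. by move=> opA; split=> a b c; rewrite ?opA. Qed.

(* EDS(Omega, op, op) *)
Definition eds_of_semigroup (Omega : Type) (op : Omega -> Omega -> Omega)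
  (opA : associative op) : eds Omega := eds_of_dias (assoc_dias opA).

Section Nondegenerate.
Variables (Omega : Type) (E : eds Omega).

Definition phi_left (x : Omega * Omega) : Omega * Omega :=
  (larr E x.1 x.2, ltri E x.1 x.2).

Definition phi_right (x : Omega * Omega) : Omega * Omega :=
  (rarr E x.1 x.2, rtri E x.1 x.2).

Definition nondegenerate : Prop := bijective phi_left /\ bijective phi_right.

End Nondegenerate.

Section Inverse.
Variables (T U : Type) (f : T -> U) (bij_f : bijective f).

Lemma bij_inv_exists : exists2 g : U -> T, cancel f g & cancel g f.
Proof. by case: bij_f => g fK gK; exists g. Qed.

(* [bijective] lives in [Prop], so the inverse function is extracted by
   choice; it is unique by [bij_invK] and [bij_invKV]. *)
Definition bij_inv : U -> T := s2val (cid2 bij_inv_exists).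

Lemma bij_invK : cancel f bij_inv.
Proof. exact: (s2valP (cid2 bij_inv_exists)). Qed.

Lemma bij_invKV : cancel bij_inv f.
Proof. exact: (s2valP' (cid2 bij_inv_exists)). Qed.

End Inverse.

Section InverseOperations.
Variables (Omega : Type) (E : eds Omega) (nd : nondegenerate E).

(* [lcurv], [rcurv] are the curved arrows and [lbtri], [rbtri] the black
   triangles:
     phi_left^-1 (a, b) = (lcurv a b, lbtri a b),
     phi_right^-1 (a, b) = (rbtri b a, rcurv b a).
   The arguments are swapped on the right-hand side of the second equation. *)
Definition lcurv (a b : Omega) : Omega := (bij_inv nd.1 (a, b)).1.
Definition lbtri (a b : Omega) : Omega := (bij_inv nd.1 (a, b)).2.
Definition rcurv (a b : Omega) : Omega := (bij_inv nd.2 (b, a)).2.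
Definition rbtri (a b : Omega) : Omega := (bij_inv nd.2 (b, a)).1.

End InverseOperations.

(* The group axioms for an associative [op], stated on a bare type because the
   library's [groupType] also carries a choice structure. *)
Definition group_laws (Omega : Type) (op : Omega -> Omega -> Omega)
    (e : Omega) (inv : Omega -> Omega) : Prop :=
  [/\ associative op, left_id e op, right_id e op,
      left_inverse e inv op & right_inverse e inv op].

Definition is_group (Omega : Type) (op : Omega -> Omega -> Omega) : Prop :=
  exists e inv, group_laws op e inv.

(* Main.v *)
(* For EDS(Omega, op, op), phi_left (a, b) = (a b, b) and
   phi_right (a, b) = (a b, a), so surjectivity says that the equations x b = a
   and a y = b are solvable; in a nonempty semigroup this makes a group. *)

Require Import Defs.
From mathcomp Require Import all_boot.
From mathcomp Require Import boolp classical_sets functions.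

Lemma cancel_set_surjT (T U : Type) (f : T -> U) (g : U -> T) :
  cancel g f -> set_surj setT setT f.
Proof. by move=> gK y _; exists (g y); rewrite ?gK. Qed.

(** [bij_inv] comes from choice and does not compute; injectivity of [f] lets its values be read off
    from known preimages. *)
Lemma bij_inv_eq {T U : Type} {f : T -> U} (bij_f : bijective f) {x y} :
  f x = y -> bij_inv bij_f y = x.
Proof. by move=> <-; exact: bij_invK. Qed.

Lemma divisible_is_group (T : Type) (op : T -> T -> T) :
  inhabited T -> associative op ->
  (forall a b, exists x, op x b = a) -> (forall a b, exists y, op a y = b) ->
  is_group op.
Proof.
move=> [w] opA ldiv rdiv.
have [e ew] := ldiv w w; have [e' we'] := rdiv w w.
(* every b is w y, so a left unit for the single element w is a left unit *)
have op1 b : op e b = b by have [y <-] := rdiv w b; rewrite opA ew.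
have op1' b : op b e' = b by have [x <-] := ldiv b w; rewrite -opA we'.
(* The two one-sided units agree, since both equal [op e e']. *)
have ee' : e' = e by rewrite -[e']op1 op1'.
rewrite {}ee' in op1'.
have [inv invl] := boolp.choice (ldiv e).
exists e, inv; split=> // a.
have [y ay] := rdiv a e.
(* The chosen left inverse equals the right inverse [y]: [inv a = inv a (a y) = (inv a a) y = y]. *)
suff -> : inv a = y by [].
by rewrite -[LHS]op1' -ay opA invl op1.
Qed.

Section SemigroupEDS.
Context {Omega : Type} {op : Omega -> Omega -> Omega}.
Context (opA : associative op).
Let E := eds_of_semigroup opA.

Lemma surj_phi_is_group :
  inhabited Omega -> set_surj setT setT (phi_left E) ->
  set_surj setT setT (phi_right E) -> is_group op.
Proof.
move=> Omega0 sl sr; apply: divisible_is_group => // a b.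
(* The second coordinate of the target fixes the known factor; the first coordinate is the equation
   to solve. *)
- by have [[x y] _ [/= <- <-]] := sl (a, b) I; exists x.
- by have [[x y] _ [/= <- <-]] := sr (b, a) I; exists y.
Qed.

Context {e : Omega} {inv : Omega -> Omega} (opG : group_laws op e inv).

(** An explicit preimage of [(a, b)], which serves both for bijectivity and for the formulas of
    [lcurv] and [lbtri]. *)
Lemma phi_left_div a b : phi_left E (op a (inv b), b) = (a, b).
Proof.
by have [_ _ op1 invl _] := opG; rewrite /phi_left /= -opA invl op1.
Qed.

Lemma phi_right_div a b : phi_right E (a, op (inv a) b) = (b, a).
Proof.
by have [_ op1 _ _ invr] := opG; rewrite /phi_right /= opA invr op1.
Qed.

Lemma group_nondegenerate : nondegenerate E.
Proof.
have [_ op1l op1r invl invr] := opG; split.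
- exists (fun x => (op x.1 (inv x.2), x.2)) => -[a b].
  + by rewrite /= -opA invr op1r.
  + exact: phi_left_div.
(* [phi_right] keeps the left factor in its second coordinate, hence the swap. *)
- exists (fun x => (x.2, op (inv x.2) x.1)) => -[a b].
  + by rewrite /= opA invl op1l.
  + exact: phi_right_div.
Qed.

End SemigroupEDS.

Theorem lemma7 (Omega : Type) (op : Omega -> Omega -> Omega)
    (Omega_nonempty : inhabited Omega) (opA : associative op) :
  let E := eds_of_semigroup opA in
  [<-> nondegenerate E;
       set_surj setT setT (phi_left E) /\ set_surj setT setT (phi_right E);
       is_group op] /\
  (forall (nd : nondegenerate E) (e : Omega) (inv : Omega -> Omega),
     group_laws op e inv ->
     forall a b : Omega,
       [/\ lcurv nd a b = op a (inv b),
           rcurv nd a b = op (inv a) b,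
           lbtri nd a b = b
         & rbtri nd a b = a]).
Proof.
move=> E; split.
  tfae.
  - by move=> [[fl _ flK] [fr _ frK]]; split;
      [exact: cancel_set_surjT flK | exact: cancel_set_surjT frK].
  - by move=> [sl sr]; exact: surj_phi_is_group Omega_nonempty sl sr.
  - by move=> [e [inv opG]]; exact: group_nondegenerate opG.
move=> nd e inv opG a b; rewrite /lcurv /rcurv /lbtri /rbtri.
(* [rcurv] and [rbtri] evaluate the inverse at [(b, a)], the target in [phi_right_div]. *)
by rewrite (bij_inv_eq nd.1 (phi_left_div opA opG a b))
  (bij_inv_eq nd.2 (phi_right_div opA opG a b)).
Qed.
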